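(* Fix a first-hop channel gain realization $f=(f_1,\dots,f_L)\in\mathbb{C}^L$ and $\gamma>0$, and let $W^*(\gamma)=\sup_M E(Y_M-\gamma T_M)$, the supremum being over all sub-layer stopping rules $M$. The optimal stopping rule for maximizing $E(Y_M-\gamma T_M)$ is of the form $$M^*(\gamma)=\min\left\{m\ge1:\tfrac T2R_m\ge W^*(\gamma)+\tfrac T2\gamma\right\},$$ where $W^*(\gamma)$ satisfies the equation $$E\left[\max\left(\tfrac T2R_m-\tfrac T2\gamma,\;W^*(\gamma)\right)\right]=W^*(\gamma)+\frac{\gamma\tau}{2p_r}.$$ (All expectations are conditional on $f$.)
   Context: Let $L\ge1$ be an integer (number of relays), $T,\tau,P_s,P_r,\sigma_g^2>0$ constants, $p_1\in(0,1)$, and $p_r=Lp_1(1-p_1)^{L-1}$. The vector $f=(f_1,\dots,f_L)$ consists of the fixed, already known channel gains from the transmitting source to the $L$ relays. Sub-layer observations are indexed by $m=1,2,\dots$. In observation $m$: the winning relay $s(m)$ is uniform on $\{1,\dots,L\}$; the number of contention slots $K_m$ is geometric, $\mathrm{Prob}(K_m=k)=p_r(1-p_r)^{k-1}$, $k\ge1$; the second-hop gains $g_1(m),\dots,g_L(m)$ are (circularly symmetric) complex Gaussian with mean zero and variance $E|g_j(m)|^2=\sigma_g^2$. All these random variables are mutually independent, within and across observations. Put $$R_m=\log_2\left(1+\frac{P_sP_r|f_{s(m)}|^2|g_{s(m)}(m)|^2}{1+P_s|f_{s(m)}|^2+P_r|g_{s(m)}(m)|^2}\right),\quad Y_m=\tfrac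 T2R_m,\quad T_m=\tfrac T2+\tfrac\tau2\sum_{i=1}^mK_i.$$ A sub-layer stopping rule is a stopping time $M$ with values in $\{1,2,\dots\}$ with respect to the filtration generated by $(s(m),K_m,g_{s(m)}(m))$, $m\ge1$, with $E(T_M)<\infty$. *)

(* Defs.v *)
From HB Require Import structures.
From mathcomp Require Import all_boot all_order all_algebra finmap.
From mathcomp Require Export complex.
From mathcomp Require Import all_classical all_reals all_analysis.

Set Implicit Arguments.
Unset Strict Implicit.
Unset Printing Implicit Defensive.

Import Order.TTheory GRing.Theory Num.Theory.
Import numFieldNormedType.Exports.

Local Open Scope classical_set_scope.
Local Open Scope ring_scope.
Local Open Scope complex_scope.

(* R[i] carries the sigma-algebra pulled back from the product Borel
   sigma-algebra of R * R along z |-> (Re z, Im z), that is, the Borel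
   sigma-algebra of the plane. *)
Section complex_measurable.
Variable R : realType.

HB.instance Definition _ := isPointed.Build R[i] 0.

Definition ReIm (z : R[i]) : R * R := (complex.Re z, complex.Im z).

Definition complex_measurable : set (set R[i]) :=
  g_sigma_algebra_preimage ReIm.

Lemma complex_measurable0 : complex_measurable set0.
Proof. exact: (@measurable0 _ (g_sigma_algebra_preimageType ReIm)). Qed.

Lemma complex_measurableC A : complex_measurable A -> complex_measurable (~` A).
Proof. exact: (@measurableC _ (g_sigma_algebra_preimageType ReIm)). Qed.

Lemma complex_measurable_bigcup (F : (set R[i])^nat) :
  (forall n, complex_measurable (F n)) -> complex_measurable (\bigcup_n F n).
Proof.
exact: (@bigcupT_measurable _ (g_sigma_algebra_preimageType ReIm)).
Qed.

HB.instance Definition _ := @isMeasurable.Build default_measure_display R[i]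
  complex_measurable complex_measurable0 complex_measurableC
  complex_measurable_bigcup.

End complex_measurable.

Section probability_notions.
Context d (Omega : measurableType d) (R : realType) (P : probability Omega R).

(* The real and imaginary parts are independent N(0, v / 2), so that the mean
   is 0 and E|X|^2 = v; normal_prob takes a standard deviation. *)
Definition circular_gaussian (v : R) (X : {RV P >-> R[i]}) : Prop :=
  forall C : set (R * R), measurable C ->
    distribution P X (@ReIm R @^-1` C) =
    (normal_prob 0 (Num.sqrt (v / 2)) \x normal_prob 0 (Num.sqrt (v / 2)))%E C.

Definition mutually_independent (I : choiceType) (D : set I)
    (G : I -> set_system Omega) : Prop :=
  forall (J : {fset I}) (A : I -> set Omega),
    [set` J] `<=` D -> (forall i, i \in J -> G i (A i)) ->
    P (\bigcap_(i in [set` J]) A i) = (\prod_(i <- J) P (A i))%E.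

(* None stands for the value +oo. *)
Definition stopping_time (F : nat -> set_system Omega)
    (M : Omega -> option nat) : Prop :=
  forall n, F n (M @^-1` [set Some n]).

(* X_M; the value on {M = +oo} is immaterial for almost surely finite M. *)
Definition stopped (X : nat -> Omega -> R) (M : Omega -> option nat)
    (w : Omega) : R :=
  if M w is Some n then X n w else 0.

(* The least m >= 1 with C m w, +oo if there is none. *)
Definition first_time (C : nat -> Omega -> bool) (w : Omega) : option nat :=
  match pselect (exists m, (0 < m)%N && C m w) with
  | left ex => Some (ex_minn ex)
  | right _ => None
  end.

End probability_notions.

Section relay_model.
Context d (Omega : measurableType d) (R : realType) (P : probability Omega R).
Variable L : nat.
Variables T tau Ps Pr p1 : R.
Variable f : 'I_L -> R[i].
Variable s : nat -> Omega -> 'I_L.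
Variable K : nat -> {RV P >-> nat}.
Variable g : nat -> 'I_L -> {RV P >-> R[i]}.

Definition p_r : R := L%:R * p1 * (1 - p1) ^+ L.-1.

Definition sigma_s (m : nat) : set_system Omega :=
  preimage_set_system setT (s m) setT.

(* (m, inl false), (m, inl true) and (m, inr j) index s(m), K_m and g_j(m). *)
Definition model_sigma (i : nat * (bool + 'I_L)) : set_system Omega :=
  match i with
  | (m, inl false) => sigma_s m
  | (m, inl true) => g_sigma_algebra_preimage (K m)
  | (m, inr j) => g_sigma_algebra_preimage (g m j)
  end.

(* Observations are numbered from 1; index 0 is never used. *)
Record relay_observations (sigmag2 : R) : Prop := RelayObservations {
  winner_measurable :
    forall m, (0 < m)%N -> sigma_s m `<=` measurable;
  winner_uniform :
    forall m j, (0 < m)%N -> P (s m @^-1` [set j]) = (L%:R^-1)%:E;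
  slots_geometric :
    forall m k, (0 < m)%N -> (0 < k)%N ->
      distribution P (K m) [set k] = (p_r * (1 - p_r) ^+ k.-1)%:E;
  gain_gaussian :
    forall m j, (0 < m)%N -> circular_gaussian sigmag2 (g m j);
  observations_independent :
    mutually_independent P [set i | (0 < i.1)%N] model_sigma }.

Definition winner_gain (m : nat) (w : Omega) : R[i] := g m (s m w) w.

Definition filtration (n : nat) : set_system Omega :=
  <<s \bigcup_(m in [set m | (0 < m <= n)%N])
        (sigma_s m `|` g_sigma_algebra_preimage (K m)
         `|` g_sigma_algebra_preimage (winner_gain m)) >>.

Definition sqmod (z : R[i]) : R := ComplexField.Normc.normc z ^+ 2.

Definition log2 (x : R) : R := ln x / ln 2.

Definition rate (m : nat) (w : Omega) : R :=
  let f2 := sqmod (f (s m w)) in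
  let g2 := sqmod (winner_gain m w) in
  log2 (1 + Ps * Pr * f2 * g2 / (1 + Ps * f2 + Pr * g2)).

Definition payoff (m : nat) (w : Omega) : R := T / 2 * rate m w.

Definition elapsed (m : nat) (w : Omega) : R :=
  T / 2 + tau / 2 * \sum_(1 <= i < m.+1) (K i w)%:R.

Definition reward (gamma : R) (m : nat) (w : Omega) : R :=
  payoff m w - gamma * elapsed m w.

(* Finiteness is only almost sure: on the null event where no observation
   reaches the threshold, the minimum defining the optimal rule is +oo. *)
Definition stopping_rule (M : Omega -> option nat) : Prop :=
  [/\ stopping_time filtration M,
      forall w, M w <> Some 0%N,
      P (M @^-1` [set None]) = 0%E &
      ('E_P[stopped elapsed M] < +oo)%E].

Definition opt_value (gamma : R) : \bar R :=
  ereal_sup [set 'E_P[stopped (reward gamma) M] | M in stopping_rule]%E.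

Definition threshold_rule (gamma W : R) : Omega -> option nat :=
  first_time (fun m w => W + T / 2 * gamma <= T / 2 * rate m w).

End relay_model.

(* Main.v *)
Require Import Defs.
From mathcomp Require Import all_boot all_order all_algebra finmap.
From mathcomp Require Import all_classical all_reals all_analysis.
From mathcomp Require Import measurable_realfun ring lra.

(** Write X_m = (T/2)(R_m - gamma), so that the reward after n observations is
    X_n - a (K_1 + ... + K_n) with a = gamma tau / 2; the rate, hence X, is
    bounded because the second hop cannot improve on the first.  The map
    W |-> E (X - W)^+ is continuous and takes arbitrarily large values and the
    value 0, so some W satisfies E (X - W)^+ = a / p_r, the mean cost of one
    observation.  For any rule M, X_M - W is at most the sum of (X_m - W)^+ over
    m <= M.  The event {M >= m} depends on the past and is independent of
    observation m, so by Wald's identity this sum and the total cost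
    a (K_1 + ... + K_M) both have expectation (a / p_r) E M; hence the expected
    reward is at most W.  For the rule stopping as soon as X_m >= W the bound on
    X_M - W is an equality. *)

Set Implicit Arguments.
Unset Strict Implicit.
Unset Printing Implicit Defensive.

Import Order.TTheory GRing.Theory Num.Theory.
Import numFieldNormedType.Exports.

Local Open Scope ring_scope.
Local Open Scope complex_scope.

(** * Independence of disjoint families *)

Section independence.
Local Open Scope classical_set_scope.
Local Open Scope ereal_scope.
Context d (Omega : measurableType d) (R : realType) (P : probability Omega R).

(** Dynkin's pi-lambda argument: the measurable events independent of the fixed [B] form a Dynkin
    system containing the pi-system [C]. *)
Lemma generated_independent (C : set_system Omega) (B : set Omega) :
  setI_closed C -> C `<=` measurable -> measurable B ->
  (forall A, C A -> P (A `&` B) = P A * P B) ->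
  forall A, <<s C >> A -> measurable A /\ P (A `&` B) = P A * P B.
Proof.
move=> CI mC mB CB.
pose H := [set A | measurable A /\ P (A `&` B) = P A * P B].
suff: <<s C >> `<=` H by [].
apply: lambda_system_subset => //; last first.
  by move=> A CA; split; [exact: mC|exact: CB].
apply/dynkin_lambda_system; split.
- by split; [exact: measurableT|rewrite setTI probability_setT mul1e].
- move=> A [mA AB]; split; first exact: measurableC.
  rewrite probability_setC// setIC -setDE measureD ?ltey_eq ?fin_num_measure//.
  rewrite -setIC; transitivity (P B - P A * P B); first by rewrite -AB.
  rewrite -{1}(mul1e (P B)) -muleBl ?fin_num_measure//.
- move=> F tF HF; split.
    by apply: bigcupT_measurable => k; have [] := HF k.
  rewrite setI_bigcupl measure_bigcup//=; last first.
    exact: trivIset_setIr.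
    by move=> k _; apply: measurableI => //; have [] := HF k.
  rewrite measure_bigcup//; last by move=> k _; have [] := HF k.
  rewrite -(fineK (fin_num_measure P B mB)) muleC -nneseriesZl//.
  apply: eq_eseriesr => k _.
  by rewrite muleC fineK ?fin_num_measure//; have [] := HF k.
Qed.

(* Taking F i = setT off the finite set J lets two cylinders be intersected
   coordinatewise. *)
Definition cylinder (I : choiceType) (G : I -> set_system Omega) (D : set I)
    (A : set Omega) : Prop :=
  exists (J : {fset I}) (F : I -> set Omega),
    [/\ [set` J] `<=` D, forall i, i \in J -> G i (F i),
        forall i, i \notin J -> F i = setT & A = \bigcap_i F i].

Section cylinder.
Variables (I : choiceType) (G : I -> set_system Omega) (D : set I).
Hypothesis GI : forall i, D i -> setI_closed (G i).
Hypothesis mG : forall i, D i -> G i `<=` measurable.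
Hypothesis indepG : mutually_independent P D G.

Lemma cylinder_bigcap (J : {fset I}) (F : I -> set Omega) :
  (forall i, i \notin J -> F i = setT) ->
  \bigcap_i F i = \bigcap_(i in [set` J]) F i.
Proof.
move=> FT; apply/seteqP; split => w Fw i.
  by move=> _; exact: Fw.
move=> _; have [iJ|iJ] := boolP (i \in J); first exact: Fw.
by rewrite FT.
Qed.

Lemma cylinder1 i A : D i -> G i A -> cylinder G [set i] A.
Proof.
move=> Di GA; exists [fset i]%fset, (fun k => if k == i then A else setT).
split=> [k /=|k|k|].
- by rewrite inE => /eqP.
- by rewrite inE => /eqP ->; rewrite eqxx.
- by rewrite inE => /negbTE ->.
- apply/seteqP; split => [w Aw k _|w /(_ i Logic.I)]; last by rewrite eqxx.
  by case: eqP.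
Qed.

Lemma sub_cylinder (D1 D2 : set I) : D1 `<=` D2 ->
  cylinder G D1 `<=` cylinder G D2.
Proof.
move=> D12 A [J [F [JD FG FT ->]]]; exists J, F; split => //.
exact: subset_trans JD D12.
Qed.

Lemma cylinder_setI D' : D' `<=` D -> setI_closed (cylinder G D').
Proof.
move=> D'D A B [J [F [JD FG FT ->]]] [J' [F' [JD' FG' FT' ->]]].
exists (J `|` J')%fset, (fun i => F i `&` F' i); split => [i /=|i|i|].
- by rewrite inE => /orP[/JD|/JD'].
- rewrite inE.
  have [iJ|iJ] := boolP (i \in J); have [iJ'|iJ'] := boolP (i \in J') => //= _.
  + by apply: GI; [exact/D'D/JD|exact: FG|exact: FG'].
  + by rewrite (FT' i)// setIT; exact: FG.
  + by rewrite (FT i)// setTI; exact: FG'.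
- by rewrite inE negb_or => /andP[iJ iJ']; rewrite FT// FT'// setIT.
- by rewrite bigcapI.
Qed.

Lemma cylinder_measurable D' : D' `<=` D -> cylinder G D' `<=` measurable.
Proof.
move=> D'D A [J [F [JD FG FT ->]]].
rewrite (cylinder_bigcap FT); apply: fin_bigcap_measurable.
  exact: finite_fset.
by move=> i iJ; apply: (mG (i := i)); [exact/D'D/JD|exact: FG].
Qed.

(** On disjoint index sets each coordinate of the intersection comes from one cylinder only, so the
    product over the union of [J] and [J'] splits. *)
Lemma cylinder_independent (D1 D2 : set I) A B :
  D1 `<=` D -> D2 `<=` D -> [disjoint D1 & D2] ->
  cylinder G D1 A -> cylinder G D2 B -> P (A `&` B) = P A * P B.
Proof.
move=> D1D D2D D12 [J [F [JD FG FT ->]]] [J' [F' [JD' FG' FT' ->]]].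
have JJ' i : i \in J -> i \in J' -> False.
  move=> /JD iD1 /JD' iD2.
  by have : (D1 `&` D2) i by []; move/disj_set2P : D12 => ->.
pose F'' i := F i `&` F' i.
have F''T i : i \notin (J `|` J')%fset -> F'' i = setT.
  by rewrite inE negb_or => /andP[iJ iJ']; rewrite /F'' FT// FT'// setIT.
have F''1 i : i \in J -> F'' i = F i.
  move=> iJ; rewrite /F'' (FT' i) ?setIT//.
  by apply/negP => /(JJ' _ iJ).
have F''2 i : i \in J' -> F'' i = F' i.
  move=> iJ; rewrite /F'' (FT i) ?setTI//.
  by apply/negP => /JJ'; exact.
rewrite -bigcapI (cylinder_bigcap F''T) (cylinder_bigcap FT).
rewrite (cylinder_bigcap FT') !indepG//.
- rewrite (perm_big (enum_fset J ++ enum_fset J')) /=; last first.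
    apply: uniq_perm; rewrite ?cat_uniq ?fset_uniq ?andbT//=.
      by apply/hasPn => i iJ'; apply/negP => iJ; exact: (JJ' i).
    by move=> i; rewrite mem_cat inE.
  rewrite big_cat/=; congr (_ * _).
    by apply: eq_big_seq => i iJ; rewrite F''1.
  by apply: eq_big_seq => i iJ; rewrite F''2.
- exact: subset_trans JD' D2D.
- exact: subset_trans JD D1D.
- move=> i /=; rewrite inE => /orP[/JD /D1D//|/JD' /D2D//].
- move=> i; rewrite inE => /orP[iJ|iJ].
    by rewrite F''1//; exact: FG.
  by rewrite F''2//; exact: FG'.
Qed.

Lemma past_independent (D1 D2 : set I) A B :
  D1 `<=` D -> D2 `<=` D -> [disjoint D1 & D2] ->
  <<s cylinder G D1 >> A -> cylinder G D2 B ->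
  measurable A /\ P (A `&` B) = P A * P B.
Proof.
move=> D1D D2D D12 sA cB; move: A sA; apply: generated_independent.
- exact: cylinder_setI.
- exact: cylinder_measurable.
- exact: cylinder_measurable cB.
- by move=> A cA; exact: (cylinder_independent D1D D2D).
Qed.

End cylinder.

Lemma integral_mrestr (E : set Omega) (mE : measurable E) f :
  measurable_fun [set: Omega] f -> (forall w, 0 <= f w) ->
  \int[mrestr P mE]_w f w = \int[P]_(w in E) f w.
Proof.
move=> mf f0.
rewrite [RHS](@eq_measure_integral _ _ _ _ (mrestr P mE)); last first.
  by move=> A mA AE; rewrite /mrestr -{1}(setIidl AE).
rewrite (ge0_negligible_integral (N := ~` E) (D := setT))//=.
- by rewrite setTD setCK.
- exact: measurableC.
- by rewrite /mrestr/= setICl measure0.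
Qed.

(** The push-forward by [Y] of [P] restricted to [E] is [P E] times the law of [Z]. The last
    hypothesis holds when [Y] is independent of [E] and has the law of [Z], so [Z] may be a
    reference copy of [Y]. *)
Lemma integral_independent d' (T : measurableType d') (E : set Omega)
  (Y Z : Omega -> T) (phi : T -> \bar R) :
  measurable E -> measurable_fun [set: Omega] Y ->
  measurable_fun [set: Omega] Z ->
  measurable_fun [set: T] phi -> (forall y, 0 <= phi y) ->
  (forall C, measurable C -> P (E `&` Y @^-1` C) = P E * P (Z @^-1` C)) ->
  \int[P]_(w in E) phi (Y w) = P E * \int[P]_w phi (Z w).
Proof.
move=> mE mY mZ mphi phi0 EYZ.
rewrite -(integral_mrestr mE (measurableT_comp mphi mY)); last first.
  by move=> w; exact: phi0.
rewrite -(@ge0_integral_pushforward _ _ _ _ _ _ mY (mrestr P mE) setT phi)//.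
rewrite -(@ge0_integral_pushforward _ _ _ _ _ _ mZ P setT phi)//.
have PE0 : (0 <= fine (P E))%R by exact: fine_ge0.
rewrite -[in RHS](fineK (fin_num_measure P E mE)).
rewrite -(ge0_integral_mscale _ measurableT (NngNum PE0))//.
apply: eq_measure_integral => C mC _.
change (P (Y @^-1` C `&` E) = (fine (P E))%:E * P (Z @^-1` C)).
by rewrite fineK ?fin_num_measure// setIC EYZ.
Qed.
End independence.

(** * Wald's identity *)

Section stopping.
Local Open Scope classical_set_scope.
Local Open Scope ereal_scope.
Context d (Omega : measurableType d) (R : realType) (P : probability Omega R).
Variable M : Omega -> option nat.
Hypothesis mM : forall n, measurable (M @^-1` [set Some n]).
Hypothesis M0 : forall w, M w <> Some 0%N.

Lemma measurable_never : measurable (M @^-1` [set None]).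
Proof.
rewrite (_ : _ @^-1` _ = ~` \bigcup_n M @^-1` [set Some n]).
  exact/measurableC/bigcupT_measurable.
apply/seteqP; split => w /=; first by move=> Mw [n _ /=]; rewrite Mw.
by case E : (M w) => [n|//] []; exists n.
Qed.

Lemma measurable_stopped (X : nat -> Omega -> R) :
  (forall n, (0 < n)%N -> measurable_fun [set: Omega] (X n)) ->
  measurable_fun [set: Omega] (stopped X M).
Proof.
move=> mX.
(* Index 0 holds the event M = +oo and finite values are shifted by one; [E 1], the event M = 0, is
   empty by [M0]. *)
pose E n := if n is k.+1 then M @^-1` [set Some k] else M @^-1` [set None].
have ET : [set: Omega] = \bigcup_n E n.
  apply/seteqP; split => // w _; case Mw : (M w) => [n|].
    by exists n.+1.
  by exists 0%N.
have mE n : measurable (E n) by case: n => [|n] //=; exact: measurable_never.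
rewrite ET; apply/measurable_fun_bigcup => // -[|[|n]] /=.
- apply: (eq_measurable_fun (fun=> 0%R : R)) => // w; rewrite inE /= => Mw.
  by rewrite /stopped Mw.
- rewrite (_ : _ @^-1` _ = set0); first exact: measurable_fun_set0.
  by apply/seteqP; split => // w /= /M0.
- apply: (eq_measurable_fun (X n.+1)) => [w|].
    by rewrite inE /= /stopped => ->.
  exact: measurable_funTS (mX _ _).
Qed.

(** [stopped] takes the default value 0 where M = +oo, so identities between stopped variables may
    break there, but only on a null event. *)
Lemma stopped_ae_expectation (f g : Omega -> R) :
  measurable_fun [set: Omega] f -> measurable_fun [set: Omega] g ->
  P (M @^-1` [set None]) = 0 -> (forall w, M w <> None -> f w = g w) ->
  'E_P[f] = 'E_P[g].
Proof.
move=> mf mg P0 fg; rewrite unlock.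
apply: ae_eq_integral => //; [exact/measurable_EFinP|exact/measurable_EFinP|].
exists (M @^-1` [set None]); split; [exact: measurable_never|exact: P0|].
move=> w /= fgw; apply: contrapT => Mw.
by apply: fgw => _; rewrite fg.
Qed.

(* The event M >= m, which includes M = +oo. *)
Definition running (m : nat) : set Omega :=
  ~` \big[setU/set0]_(k < m) M @^-1` [set Some (k : nat)].

Lemma runningP m w : running m w <-> if M w is Some n then (m <= n)%N else True.
Proof.
rewrite /running -(bigcup_mkord _ (fun k => M @^-1` [set Some k])).
case Mw : (M w) => [n|]; split=> //.
- move=> Hm; rewrite leqNgt; apply/negP => nm; apply: Hm.
  by exists n.
- by move=> mn [k /=]; rewrite Mw => km [nk]; move: mn; rewrite nk leqNgt km.
- by move=> _ [k _ /=]; rewrite Mw.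
Qed.

Lemma measurable_running m : measurable (running m).
Proof. by apply: measurableC; apply: bigsetU_measurable => k _; exact: mM. Qed.

(* E M as a sum of tails; it is +oo when M = +oo has positive probability. *)
Definition mean_duration : \bar R := \sum_(0 <= m <oo) P (running m.+1).

Lemma mean_duration_ge0 : 0 <= mean_duration.
Proof. by apply: nneseries_ge0 => m _ _; exact: measure_ge0. Qed.

(** Tonelli, term by term. Rules that may never stop are covered, so this can later help to show
    that the threshold rule does stop. *)
Lemma integral_running_series (Z : nat -> Omega -> R) (z : R) : (0 <= z)%R ->
  (forall m, measurable_fun [set: Omega] (Z m.+1)) ->
  (forall m w, (0 <= Z m.+1 w)%R) ->
  (forall m, \int[P]_(w in running m.+1) (Z m.+1 w)%:E
             = P (running m.+1) * z%:E) ->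
  \int[P]_w \sum_(0 <= m <oo) (((EFin \o Z m.+1) \_ (running m.+1)) w)
  = mean_duration * z%:E.
Proof.
move=> z0 mZ Z0 intZ.
rewrite integral_nneseries//; last first.
  move=> m w _; apply: erestrict_ge0 => x _ /=; rewrite lee_fin; exact: Z0.
  move=> m; apply/(measurable_restrictT _ (measurable_running m.+1)).
  by apply: measurable_funTS; exact/measurable_EFinP.
rewrite muleC -nneseriesZl; last by move=> m _; exact: measure_ge0.
apply: eq_eseriesr => m _; rewrite -integral_mkcond muleC; exact: intZ.
Qed.

(** Almost surely the sum stopped at [M] equals the series of the terms [Z m.+1] restricted to
    [running m.+1], whose integral is known. *)
Lemma wald (Z : nat -> Omega -> R) (z : R) : (0 <= z)%R ->
  (forall m, measurable_fun [set: Omega] (Z m.+1)) ->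
  (forall m w, (0 <= Z m.+1 w)%R) ->
  (forall m, \int[P]_(w in running m.+1) (Z m.+1 w)%:E
             = P (running m.+1) * z%:E) ->
  P (M @^-1` [set None]) = 0 ->
  'E_P[stopped (fun n w => \sum_(1 <= i < n.+1) Z i w)%R M]
  = mean_duration * z%:E.
Proof.
move=> z0 mZ Z0 intZ P0; rewrite -(integral_running_series z0 mZ Z0 intZ) unlock.
apply: ae_eq_integral => //.
- apply/measurable_EFinP/measurable_stopped => n _.
  rewrite (_ : (fun w => _) = (fun w => \sum_(i < n) Z i.+1 w)%R); last first.
    by apply/funext => w; rewrite big_add1 /= big_mkord.
  by apply: measurable_sum => i; exact: mZ.
- apply: ge0_emeasurable_sum => // [m w _ _|m _].
    apply: erestrict_ge0 => x _ /=; rewrite lee_fin; exact: Z0.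
  apply/(measurable_restrictT _ (measurable_running m.+1)).
  by apply: measurable_funTS; exact/measurable_EFinP.
exists (M @^-1` [set None]); split; [exact: measurable_never|exact: P0|].
move=> w /= fgw; apply: contrapT => Mw.
apply: fgw => _; rewrite /stopped; case E : (M w) => [n|//].
rewrite (nneseries_split 0 n); last first.
  by move=> k _; apply: erestrict_ge0 => x _ /=; rewrite lee_fin.
rewrite [X in _ + X]eseries0 ?adde0; last first.
  move=> k nk _; rewrite /patch memNset// => /runningP; rewrite E.
  by rewrite leqNgt ltnS -[X in (X <= _)%N]add0n nk.
rewrite add0n -sumEFin big_add1 /= !big_mkord; apply: eq_bigr => k _.
by rewrite /patch mem_set//; apply/runningP; rewrite E.
Qed.

End stopping.

(** * Optimal stopping with a constant mean cost per observation *)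

Lemma ge0_Lfun1 d (Omega : measurableType d) (R : realType)
  (P : probability Omega R) (f : Omega -> R) :
  measurable_fun [set: Omega] f -> (forall w, 0 <= f w) ->
  ('E_P[f] < +oo)%E -> f \in Lfun P 1.
Proof.
move=> mf f0 finf.
apply/Lfun1_integrable/integrableP; split; first exact/measurable_EFinP.
move: finf; rewrite unlock; congr (_ < _)%E; apply: eq_integral => w _ /=.
by rewrite ger0_norm.
Qed.

Section optimal_stopping.
Local Open Scope classical_set_scope.
Local Open Scope ereal_scope.
Context d (Omega : measurableType d) (R : realType) (P : probability Omega R).
Variables (X K : nat -> Omega -> R) (Gen : nat -> set_system Omega).
Variables (a k W b : R).
Hypothesis Gen_measurable : forall n, <<s Gen n >> `<=` measurable.
Hypothesis Gen_mono : forall m n, (m <= n)%N -> <<s Gen m >> `<=` <<s Gen n >>.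
Hypothesis mX : forall n, (0 < n)%N -> measurable_fun [set: Omega] (X n).
Hypothesis mK : forall n, (0 < n)%N -> measurable_fun [set: Omega] (K n).
Hypothesis Xb : forall n w, (`|X n w| <= b)%R.
Hypothesis K0 : forall n w, (0 <= K n w)%R.
Hypothesis a0 : (0 < a)%R.
Hypothesis k0 : (0 < k)%R.
Hypothesis excess : forall n A, <<s Gen n >> A ->
  \int[P]_(w in A) (Num.max (X n.+1 w - W) 0)%:E = P A * (a * k)%:E.
Hypothesis mean_K : forall n A, <<s Gen n >> A ->
  \int[P]_(w in A) (K n.+1 w)%:E = P A * k%:E.

Let S n w : R := (\sum_(1 <= i < n.+1) K i w)%R.
Let phi n w : R := Num.max (X n w - W)%R 0%R.
Let Phi n w : R := (\sum_(1 <= i < n.+1) phi i w)%R.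

Let mphi n : (0 < n)%N -> measurable_fun [set: Omega] (phi n).
Proof.
move=> n0; apply: measurable_maxr; last exact: measurable_cst.
by apply: measurable_funB; [exact: mX|exact: measurable_cst].
Qed.

Let phi0 n w : (0 <= phi n w)%R.
Proof. by rewrite /phi le_max lexx orbT. Qed.

Let measurable_sum1 (Z : nat -> Omega -> R) n :
  (forall i, (0 < i)%N -> measurable_fun [set: Omega] (Z i)) ->
  measurable_fun [set: Omega] (fun w => \sum_(1 <= i < n.+1) Z i w)%R.
Proof.
move=> mZ.
rewrite (_ : (fun w => _) = (fun w => \sum_(i < n) Z i.+1 w)%R); last first.
  by apply/funext => w; rewrite big_add1 /= big_mkord.
by apply: measurable_sum => i; exact: mZ.
Qed.

(** * Reward of an arbitrary stopping rule *)

Section stopping_time_reward.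
Variable M : Omega -> option nat.
Hypothesis stopM : stopping_time (fun n => <<s Gen n >>) M.
Hypothesis M0 : forall w, M w <> Some 0%N.

Let mM n : measurable (M @^-1` [set Some n]).
Proof. by apply: (Gen_measurable (n := n)); exact: stopM. Qed.

(** M >= n + 1 is the complement of M <= n, which is decided by time n. *)
Lemma running_predictable n : <<s Gen n >> (running M n.+1).
Proof.
apply: (@measurableC _ (g_sigma_algebraType (Gen n))).
apply: (@bigsetU_measurable _ (g_sigma_algebraType (Gen n))) => i _.
by apply: (@Gen_mono i n); [rewrite -ltnS|exact: stopM].
Qed.

Lemma series_excess :
  \int[P]_w \sum_(0 <= m <oo) (((EFin \o phi m.+1) \_ (running M m.+1)) w)
  = mean_duration P M * (a * k)%:E.
Proof.
apply: integral_running_series => //.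
- by rewrite mulr_ge0// ltW.
- by move=> m; exact: mphi.
- by move=> m; apply: excess; exact: running_predictable.
Qed.

Hypothesis P0 : P (M @^-1` [set None]) = 0.

Lemma wald_excess : 'E_P[stopped Phi M] = mean_duration P M * (a * k)%:E.
Proof.
apply: wald => //.
- by rewrite mulr_ge0// ltW.
- by move=> m; exact: mphi.
- by move=> m; apply: excess; exact: running_predictable.
Qed.

Lemma wald_K : 'E_P[stopped S M] = mean_duration P M * k%:E.
Proof.
apply: wald => //.
- exact: ltW.
- by move=> m; exact: mK.
- by move=> m; apply: mean_K; exact: running_predictable.
Qed.

Hypothesis finS : 'E_P[stopped S M] < +oo.

(** By Wald's identity the mean of [S] at [M] is [k > 0] times the mean duration, so an infinite
    duration would contradict [finS]. *)
Lemma mean_duration_fin : mean_duration P M \is a fin_num.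
Proof.
rewrite ge0_fin_numE; last exact: mean_duration_ge0.
move: finS; rewrite wald_K; case: (mean_duration P M) => [r _||//].
- exact: ltry.
- by rewrite gt0_mulye ?lte_fin// ltxx.
Qed.

Let S0 n w : (0 <= S n w)%R.
Proof. exact: sumr_ge0. Qed.

Let mS : measurable_fun [set: Omega] (stopped S M).
Proof. by apply: measurable_stopped => // n _; exact: measurable_sum1. Qed.

Let mXW : measurable_fun [set: Omega] (stopped (fun n w => X n w - W)%R M).
Proof.
apply: measurable_stopped => // n n0.
by apply: measurable_funB; [exact: mX|exact: measurable_cst].
Qed.

Let LX : stopped (fun n w => X n w - W)%R M \in Lfun P 1.
Proof.
apply/Lfun1_integrable; apply: measurable_bounded_integrable => //.
  exact: (le_lt_trans (probability_le1 P measurableT) (ltry 1)).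
(* This constant also dominates the default value 0, since [b] bounds an absolute value. *)
exists (b + `|W|)%R; split; first exact: num_real.
move=> r br w _ /=; apply: le_trans (ltW br).
rewrite /stopped; case: (M w) => [n|].
  by rewrite (le_trans (ler_normB _ _))// lerD2r.
by rewrite normr0 addr_ge0// (le_trans _ (Xb 0 w)).
Qed.

Let LS : stopped S M \in Lfun P 1.
Proof. by apply: ge0_Lfun1 => // w; rewrite /stopped; case: (M w). Qed.

Let LPhi : stopped Phi M \in Lfun P 1.
Proof.
apply: ge0_Lfun1.
- by apply: measurable_stopped => // n _; exact: measurable_sum1.
- by move=> w; rewrite /stopped; case: (M w) => // n; exact: sumr_ge0.
- by rewrite wald_excess -ge0_fin_numE ?fin_numM ?mean_duration_fin//
    mule_ge0 ?mean_duration_ge0// lee_fin mulr_ge0// ltW.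
Qed.

(** Where [M] is finite the reward is (X_M - W) + W - a S_M, and Wald's identity evaluates the last
    mean. Where M = +oo the reward is 0 but the decomposition gives W, hence the use of
    [stopped_ae_expectation]. *)
Lemma expectation_reward :
  'E_P[stopped (fun n w => X n w - a * S n w)%R M] =
  'E_P[stopped (fun n w => X n w - W)%R M] + W%:E
    - mean_duration P M * (a * k)%:E.
Proof.
have LW : (cst W : Omega -> R) \in Lfun P 1.
  by apply/Lfun1_integrable; exact: finite_measure_integrable_cst.
pose f := (stopped (fun n w => X n w - W) M \+ cst W \- a \o* stopped S M)%R.
transitivity 'E_P[f].
  apply: (stopped_ae_expectation mM) => //.
  - apply: measurable_stopped => // n n0.
    apply: measurable_funB; first exact: mX.
    by apply: measurable_funM => //; exact: measurable_sum1.
  - apply: measurable_funB; first by apply: measurable_funD.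
    by apply: measurable_funM.
  - by move=> w; rewrite /f /stopped /=; case: (M w) => [n _|//]; rewrite subrK mulrC.
rewrite expectationB//; last first.
  apply/Lfun1_integrable.
  apply: (@integrableZr _ _ _ _ _ measurableT a (EFin \o stopped S M)) => //.
  exact/Lfun1_integrable.
  apply/Lfun1_integrable.
  by apply: (@integrableD _ _ _ _ _ measurableT (EFin \o _) (EFin \o _)) => //;
    exact/Lfun1_integrable.
rewrite expectationD// expectation_cst expectationZl// wald_K.
by rewrite EFinM muleCA.
Qed.

Lemma stopping_le : 'E_P[stopped (fun n w => X n w - a * S n w)%R M] <= W%:E.
Proof.
have dur : mean_duration P M * (a * k)%:E \is a fin_num.
  by rewrite fin_numM ?mean_duration_fin.
(* The mean cost is also the mean of [Phi] at [M], which leaves the pointwise comparison of X_M - W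
   with [Phi]: the last summand alone suffices. *)
rewrite expectation_reward lee_subel_addr// addeC leeD2l// -wald_excess unlock.
apply: le_integral => //; [exact/Lfun1_integrable|exact/Lfun1_integrable|].
move=> w _; rewrite lee_fin /stopped; case E : (M w) => [[|n]|//].
  by move/M0 : E.
rewrite /Phi big_nat_recr//= (le_trans (y := phi n.+1 w))//.
  by rewrite /phi le_max lexx.
by rewrite lerDr sumr_ge0.
Qed.

End stopping_time_reward.

(** * The threshold rule at level [W] *)

Section threshold.
Let M := first_time (fun m w => W <= X m w)%R.

Lemma first_time_gt0 w : M w <> Some 0%N.
Proof.
rewrite /M /first_time; case: pselect => // e [].
by case: ex_minnP => m /andP[m0 _] _ m_eq0; rewrite m_eq0 in m0.
Qed.

Lemma first_timeP w n : (0 < n)%N ->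
  M w = Some n <->
  (W <= X n w)%R /\ (forall i, (0 < i < n)%N -> (X i w < W)%R).
Proof.
rewrite /M /first_time => n0; case: pselect => [e|ne]; split=> //.
- case; case: ex_minnP => m /andP[_ Wm] mmin <-; split => // i /andP[i0 im].
  rewrite ltNge; apply/negP => Wi; have := mmin i; rewrite i0 Wi => /(_ isT).
  by rewrite leqNgt im.
- case=> Wn ltn; congr Some; case: ex_minnP => m /andP[m0 Wm] mmin.
  apply/eqP; rewrite eqn_leq mmin ?n0//= leqNgt; apply/negP => mn.
  by have := ltn m; rewrite m0 mn ltNge Wm => /(_ isT).
- by case=> Wn _; exfalso; apply: ne; exists n; rewrite n0.
Qed.

Hypothesis adapted : forall n, (0 < n)%N ->
  <<s Gen n >> [set w | (W <= X n w)%R].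

Lemma first_time_stopping : stopping_time (fun n => <<s Gen n >>) M.
Proof.
case=> [|n].
  rewrite (_ : _ @^-1` _ = set0).
    exact: (@measurable0 _ (g_sigma_algebraType (Gen 0))).
  by apply/seteqP; split => // w /= /first_time_gt0.
(* M = n + 1 means that the level is reached at n + 1 but at none of the times 1, ..., n, written as
   [i.+1] with [i < n]. *)
rewrite (_ : _ @^-1` _ = [set w | (W <= X n.+1 w)%R] `\`
    \big[setU/set0]_(i < n) [set w | (W <= X i.+1 w)%R]).
  apply: (@measurableD _ (g_sigma_algebraType (Gen n.+1))); first exact: adapted.
  apply: (@bigsetU_measurable _ (g_sigma_algebraType (Gen n.+1))) => i _.
  by apply: (@Gen_mono i.+1); [exact/leqW/ltn_ord|exact: adapted].
apply/seteqP; split => w /=.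
  move/(first_timeP _ (ltn0Sn n)) => [Wn ltn]; split => //.
  rewrite -(bigcup_mkord _ (fun i => [set w | (W <= X i.+1 w)%R])).
  by case=> i /= ilt /=; rewrite leNgt ltn.
rewrite -(bigcup_mkord _ (fun i => [set w | (W <= X i.+1 w)%R])) => -[Wn ltn].
apply/first_timeP => //; split => // -[//|i] /= ilt.
by rewrite ltNge; apply/negP => Wi; apply: ltn; exists i.
Qed.

Let mM n : measurable (M @^-1` [set Some n]).
Proof. by apply: (Gen_measurable (n := n)); exact: first_time_stopping. Qed.

Let B := (b + `|W|)%R.

Let phi_le n w : (phi n w <= B)%R.
Proof.
rewrite /phi /B ge_max addr_ge0// ?(le_trans _ (Xb 0 w))// andbT.
apply: lerD; first exact: le_trans (ler_norm _) (Xb n w).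
by rewrite -normrN ler_norm.
Qed.

(* Before stopping the excess vanishes, so the series has at most one nonzero
   term; this bounds the mean duration without any tail estimate. *)
Let series_le w :
  \sum_(0 <= m <oo) (((EFin \o phi m.+1) \_ (running M m.+1)) w) <= B%:E.
Proof.
have B0 : (0 <= B)%R by exact: le_trans (phi0 0 w) (phi_le 0 w).
have ge0 m : 0 <= ((EFin \o phi m.+1) \_ (running M m.+1)) w.
  by apply: erestrict_ge0 => x _ /=; rewrite lee_fin.
have le m : ((EFin \o phi m.+1) \_ (running M m.+1)) w <= B%:E.
  by rewrite /patch; case: ifP => _; rewrite ?lee_fin//; exact: phi_le.
have zero m : M w <> Some m.+1 ->
    ((EFin \o phi m.+1) \_ (running M m.+1)) w = 0.
  move=> Mm; rewrite /patch; case: ifPn => // /set_mem /runningP run.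
  (* A positive excess at [m.+1] means that the level is reached, so [M] takes a finite value
     [n >= m.+1]; then [n > m.+1] would put X below the level at [m.+1]. *)
  congr EFin; apply/max_idPr; rewrite subr_le0 leNgt; apply/negP => Xm.
  have [e|ne] := pselect (exists m, (0 < m)%N && (W <= X m w)%R); last first.
    by apply: ne; exists m.+1; rewrite ltW.
  case E : (M w) => [n|]; last first.
    by move: E; rewrite /M /first_time; case: pselect.
  rewrite E in run.
  have n0 : (0 < n)%N by exact: leq_trans run.
  have [_ ltn] := (first_timeP w n0).1 E.
  have [mn|mn] := eqVneq m.+1 n; first by apply: Mm; rewrite E mn.
  have mlt : (m.+1 < n)%N by rewrite ltn_neqAle mn run.
  by have := ltn m.+1 mlt; rewrite ltNge (ltW Xm).
case E : (M w) => [[|n]|]; first by move/first_time_gt0 : E.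
  rewrite (nneseriesD1 (n := n))// [X in _ + X]eseries0 ?adde0//.
  move=> j _ /andP[_ jn]; apply: zero; rewrite E => -[nj].
  by rewrite nj eqxx in jn.
by rewrite eseries0// => j _ _; apply: zero; rewrite E.
Qed.

(** A series bounded pointwise by [B] has integral equal to [a * k > 0] times the mean duration. *)
Lemma mean_duration_first_time : mean_duration P M \is a fin_num.
Proof.
have : mean_duration P M * (a * k)%:E <= B%:E.
  rewrite -(series_excess first_time_stopping).
  have -> : B%:E = \int[P]_w B%:E.
    by transitivity 'E_P[cst B]; [rewrite expectation_cst|rewrite unlock].
  apply: ge0_le_integral => //.
  - by move=> w _; apply: nneseries_ge0 => m _ _;
      apply: erestrict_ge0 => x _ /=; rewrite lee_fin.
  - apply: ge0_emeasurable_sum => // [m w _ _|m _].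
      by apply: erestrict_ge0 => x _ /=; rewrite lee_fin.
    apply/(measurable_restrictT _ (measurable_running mM m.+1)).
    by apply: measurable_funTS; apply/measurable_EFinP; exact: mphi.
rewrite ge0_fin_numE ?mean_duration_ge0//.
case: (mean_duration P M) => [r _||//]; first exact: ltry.
by rewrite gt0_mulye ?lte_fin ?mulr_gt0.
Qed.

(** Every tail P(M >= m) is at least the probability of never stopping; were this positive, the sum
    of the tails would be infinite. *)
Lemma first_time_never : P (M @^-1` [set None]) = 0.
Proof.
have mN : measurable (M @^-1` [set None]) by exact: measurable_never.
have : forall n, \sum_(0 <= i < n) P (M @^-1` [set None]) <= mean_duration P M.
  move=> n; apply: le_trans (nneseries_lim_ge n _) => //.
  apply: lee_sum => i _; apply: le_measure; rewrite ?inE//.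
    exact: measurable_running.
  by move=> w /= Mw; apply/runningP; rewrite Mw.
rewrite -(fineK mean_duration_first_time) -(fineK (fin_num_measure P _ mN)).
set p := fine (P _); set D := fine _ => pD.
have p0 : (0 <= p)%R by exact: fine_ge0.
congr EFin; apply/eqP; rewrite eq_le p0 andbT leNgt; apply/negP => pgt0.
(* By the Archimedean property this many copies of [p] add up to more than [D]. *)
have := pD (Num.bound (D / p)).
rewrite big_mkord sumEFin lee_fin sumr_const card_ord -mulr_natl leNgt.
rewrite -ltr_pdivrMr// => /negP; apply.
by apply: archi_boundP; rewrite divr_ge0// fine_ge0// mean_duration_ge0.
Qed.

Lemma first_time_finite : 'E_P[stopped S M] < +oo.
Proof.
rewrite (wald_K first_time_stopping first_time_gt0 first_time_never).
by rewrite -ge0_fin_numE ?fin_numM ?mean_duration_first_time//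
  mule_ge0 ?mean_duration_ge0// lee_fin ltW.
Qed.

(** The comparison in [stopping_le] becomes an equality: excesses before [M] vanish and the one at
    [M] is X_M - W itself, so mean excess and mean cost cancel. *)
Lemma first_time_reward :
  'E_P[stopped (fun n w => X n w - a * S n w)%R M] = W%:E.
Proof.
rewrite (expectation_reward first_time_stopping first_time_gt0
  first_time_never first_time_finite).
have -> : stopped (fun n w => X n w - W)%R M = stopped Phi M.
  apply/funext => w; rewrite /stopped; case E : (M w) => [[|n]|//].
    by move/first_time_gt0 : E.
  have [Wn ltn] := (first_timeP w (ltn0Sn n)).1 E.
  rewrite /Phi big_nat_recr//= big_nat big1 ?add0r => [|i /andP[i0 i_n]].
    by apply/esym/max_idPl; rewrite subr_ge0.
  by apply/max_idPr; rewrite subr_le0 ltW// ltn// i0.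
rewrite (wald_excess first_time_stopping first_time_gt0 first_time_never).
by rewrite addeAC subee ?add0e// fin_numM ?mean_duration_first_time.
Qed.

End threshold.
End optimal_stopping.

(** * Solving for the level, and the mean of a geometric variable *)

Section analysis.
Local Open Scope classical_set_scope.
Context d (Omega : measurableType d) (R : realType) (P : probability Omega R).

(** Intermediate value theorem on [-b - c, b]: the excess is at least [c] everywhere at the left end
    and vanishes at the right end. *)
Lemma excess_level (X : Omega -> R) (b c : R) :
  measurable_fun [set: Omega] X -> (forall w, `|X w| <= b) -> 0 < c ->
  exists W : R, (\int[P]_w (Num.max (X w - W) 0)%:E = c%:E)%E.
Proof.
move=> mX Xb c0; pose h W w := Num.max (X w - W) 0.
have b0 : 0 <= b by rewrite (le_trans (normr_ge0 (X point)) (Xb point)).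
have ih W : P.-integrable setT (EFin \o h W).
  apply: measurable_bounded_integrable => //.
  - exact: (le_lt_trans (probability_le1 P measurableT) (ltry 1)).
  - apply: measurable_maxr; last exact: measurable_cst.
    by apply: measurable_funB => //; exact: measurable_cst.
  exists (b + `|W|); split; first exact: num_real.
  move=> r br w _ /=; apply: le_trans (ltW br).
  rewrite /h ger0_norm ?le_max ?lexx ?orbT// ge_max addr_ge0// andbT.
  rewrite lerD//; first exact: le_trans (ler_norm _) (Xb w).
  by rewrite -normrN ler_norm.
have icst r : P.-integrable setT (EFin \o (fun=> r : R)).
  exact: finite_measure_integrable_cst.
have intcst r : (\int[P]_w (r : R)%:E = r%:E)%E.
  by transitivity ('E_P[cst r])%E; [rewrite unlock|rewrite expectation_cst].
pose G W := fine (\int[P]_w (h W w)%:E)%E.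
have GE W : (\int[P]_w (h W w)%:E = (G W)%:E)%E.
  by rewrite fineK//; exact: integrable_fin_num (ih W).
(* The positive part is 1-Lipschitz in the level, hence so is its mean; this is the source of
   continuity. *)
have Gle W W' : G W <= G W' + `|W' - W|.
  rewrite -lee_fin EFinD -!GE -(intcst `|W' - W|).
  rewrite -(integralD_EFin measurableT (ih W') (icst _)).
  apply: le_integral => //; first exact: ih.
    exact: (integrableD measurableT (ih W') (icst _)).
  move=> w _; rewrite lee_fin /h ge_max addr_ge0 ?le_max ?lexx ?orbT// andbT.
  have := ler_norm (W' - W); have : X w - W' <= Num.max (X w - W') 0.
    by rewrite le_max lexx.
  by move: (Num.max _ _) => u; lra.
have cG : continuous G.
  move=> W; apply/cvgrPdist_le => e e0; near=> W'.
  have dW : `|W - W'| <= e by near: W'; exact: cvgr_dist_le.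
  rewrite ler_norml lerBrDl lerBlDl.
  have := Gle W W'; have := Gle W' W; rewrite distrC.
  by move: dW; rewrite distrC; move: `|_| => u; lra.
have Gb : G b = 0.
  rewrite /G (eq_integral (cst 0%E)) ?integral0// => w _ /=; congr EFin.
  by apply/max_idPr; rewrite subr_le0 (le_trans (ler_norm _)).
have Gc : c <= G (- b - c).
  rewrite -lee_fin -GE -(intcst c).
  apply: le_integral => //; [exact: icst|exact: ih|move=> w _].
  rewrite lee_fin /h le_max; apply/orP; left.
  by have := ler_norm (- X w); have := Xb w; rewrite normrN; lra.
have [] := @IVT R G (- b - c) b c.
- by lra.
- exact: continuous_subspaceT.
- by rewrite Gb ge_min le_max Gc (ltW c0) orbT.
by move=> W _ GW; exists W; rewrite GE GW.
Unshelve. all: by end_near.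
Qed.

(** E K is the sum over i of the tails P(K > i) = (1 - p)^i, a geometric series. *)
Lemma integral_geometric (K : {RV P >-> nat}) (p : R) : 0 < p <= 1 ->
  (forall k, (0 < k)%N -> P (K @^-1` [set k]) = (p * (1 - p) ^+ k.-1)%:E) ->
  (\int[P]_w (K w)%:R%:E = p^-1%:E)%E.
Proof.
move=> /andP[p0 p1] PK.
have q1 : `|1 - p| < 1 by rewrite ger0_norm; lra.
have geom a : (\sum_(0 <= j <oo) (a * (1 - p) ^+ j)%:E = (a / p)%:E)%E.
  rewrite [X in (a / X)%:E](_ : p = 1 - (1 - p)); last by lra.
  have /cvg_lim <- := cvg_geometric_series (a := a) q1; last exact: Rhausdorff.
  rewrite -EFin_lim; last exact: is_cvg_geometric_series.
  by congr (limn _); apply/funext => n /=; rewrite /series /= sumEFin.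
have mK i : measurable (K @^-1` [set k | (i < k)%N]).
  by rewrite -[X in measurable X]setTI; exact: measurable_funP.
have tail i : P (K @^-1` [set k | (i < k)%N]) = ((1 - p) ^+ i)%:E.
  (* The tail is a disjoint union over positive values, to which [PK] applies. *)
  rewrite (_ : _ @^-1` _ = \bigcup_j K @^-1` [set (j + i.+1)%N]); last first.
    apply/seteqP; split => w /=.
      by move=> iK; exists (K w - i.+1)%N => //=; rewrite subnK.
    by case=> j _ /= ->; rewrite leq_addl.
  rewrite measure_bigcup//=.
  - transitivity (\sum_(0 <= j <oo) ((p * (1 - p) ^+ i) * (1 - p) ^+ j)%:E)%E.
      rewrite (eq_eseriesl (Q := xpredT)) => [|j]; last exact: in_setT.
      apply: eq_eseriesr => j _; rewrite PK ?addnS//=.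
      by rewrite exprD mulrCA mulrC.
    by rewrite geom mulrAC divff ?mul1r// gt_eqF.
  - by move=> j _; rewrite -[X in measurable X]setTI; exact: measurable_funP.
  - by move=> j k _ _ [w [/= ->]] /addIn.
transitivity (\int[P]_w \sum_(0 <= i <oo)
    (\1_(K @^-1` [set k | (i < k)%N]) w)%:E)%E.
  apply: eq_integral => w _.
  rewrite (nneseries_split 0 (K w)); last by move=> i _; rewrite lee_fin.
  rewrite [X in (_ + X)%E]eseries0 ?adde0; last first.
    move=> i Ki _; rewrite indicE memNset//= => iK.
    by move: Ki; rewrite /= add0n leqNgt iK.
  rewrite big_mkord (eq_bigr (fun=> 1%E)); last first.
    by move=> i _; rewrite indicE mem_set//=.
  by rewrite sumEFin sumr_const card_ord.
rewrite integral_nneseries//; last first.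
  by move=> i; apply/measurable_EFinP; exact: measurable_indic.
rewrite -[p^-1]mul1r -geom; apply: eq_eseriesr => i _.
by rewrite integral_indic// setIT mul1r; exact: tail.
Qed.

End analysis.

(** * Measurability and boundedness of the rate *)

Section rate.
Local Open Scope classical_set_scope.
Context (R : realType) (Ps Pr : R).
Hypothesis (Ps_gt0 : 0 < Ps) (Pr_gt0 : 0 < Pr).

Let Ps0 : 0 <= Ps. Proof. exact: ltW. Qed.
Let Pr0 : 0 <= Pr. Proof. exact: ltW. Qed.

Lemma sqmod_ge0 (z : R[i]) : 0 <= sqmod z.
Proof. exact: sqr_ge0. Qed.

Lemma measurable_sqmod : measurable_fun [set: R[i]] (@sqmod R).
Proof.
have mReIm : measurable_fun [set: R[i]] (@ReIm R).
  by move=> _ B mB; exists B.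
rewrite (_ : @sqmod R = (fun u => u.1 ^+ 2 + u.2 ^+ 2) \o @ReIm R); last first.
  apply/funext => -[x y]; rewrite /sqmod /= sqr_sqrtr//.
  by rewrite addr_ge0// sqr_ge0.
apply: measurableT_comp => //; apply: measurable_funD.
  by apply: measurable_funX; exact: measurable_fst.
by apply: measurable_funX; exact: measurable_snd.
Qed.

(** The two gains are free arguments here: once the winner is fixed, [rate] is a deterministic
    function of the second-hop gain. *)
Definition link_rate (f z : R[i]) : R :=
  log2 (1 + Ps * Pr * sqmod f * sqmod z / (1 + Ps * sqmod f + Pr * sqmod z)).

Lemma measurable_link_rate f : measurable_fun [set: R[i]] (link_rate f).
Proof.
pose D (t : R) := 1 + Ps * sqmod f + Pr * t.
pose N (t : R) := D t + Ps * Pr * sqmod f * t.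
have D0 z : 0 < D (sqmod z).
  by rewrite /D -addrA ltr_wpDr// addr_ge0// mulr_ge0// sqmod_ge0.
have N0 z : 0 < N (sqmod z).
  rewrite /N ltr_wpDr ?D0//.
  exact: mulr_ge0 (mulr_ge0 (mulr_ge0 Ps0 Pr0) (sqmod_ge0 f)) (sqmod_ge0 z).
(* The argument of the logarithm is [N / D], both positive and affine in the squared modulus, so the
   logarithm splits into a difference. *)
rewrite (_ : link_rate f = (fun t => (ln (N t) - ln (D t)) / ln 2) \o @sqmod R).
  have mD : measurable_fun [set: R] D.
    by apply: measurable_funD => //; exact: measurable_funM.
  apply: measurableT_comp; last exact: measurable_sqmod.
  apply: measurable_funM => //; apply: measurable_funB.
    apply: measurableT_comp; first exact: measurable_ln.
    by apply: measurable_funD => //; exact: measurable_funM.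
  by apply: measurableT_comp; first exact: measurable_ln.
apply/funext => z /=; rewrite /link_rate /log2 -ln_div ?posrE//.
by congr (ln _ / _); rewrite /N mulrDl divff// gt_eqF.
Qed.

Lemma link_rate_bounds f z :
  0 <= link_rate f z <= log2 (1 + Ps * sqmod f).
Proof.
have f0 := sqmod_ge0 f; have z0 := sqmod_ge0 z.
have Pf : 0 <= Ps * sqmod f by rewrite mulr_ge0.
have Pz : 0 <= Pr * sqmod z by rewrite mulr_ge0.
have D0 : 0 < 1 + Ps * sqmod f + Pr * sqmod z by rewrite -addrA ltr_wpDr// addr_ge0.
have ln2 : 0 < ln 2 :> R by rewrite ln_gt0// ltr1n.
rewrite /link_rate /log2; set x := Ps * Pr * sqmod f * sqmod z / _.
have x0 : 0 <= x.
  exact: divr_ge0 (mulr_ge0 (mulr_ge0 (mulr_ge0 Ps0 Pr0) f0) z0) (ltW D0).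
have xP : x <= Ps * sqmod f.
  rewrite ler_pdivrMr// -subr_ge0.
  (* After clearing the denominator the terms in [Pr * sqmod z] cancel. *)
  rewrite (_ : _ - _ = Ps * sqmod f * (1 + Ps * sqmod f)); last by ring.
  by rewrite mulr_ge0// addr_ge0.
rewrite divr_ge0 ?(ltW ln2)//=; last by rewrite ln_ge0// lerDl.
rewrite ler_pM2r ?invr_gt0// ler_ln ?posrE ?lerD2l//.
  by rewrite ltr_wpDr.
by rewrite ltr_wpDr.
Qed.

End rate.

(** * The relay model *)

Lemma preimage_set_system_setI (aT rT : Type) (f : aT -> rT)
  (G : set_system rT) : setI_closed G ->
  setI_closed (preimage_set_system setT f G).
Proof.
move=> GI _ _ [A GA <-] [B GB <-]; exists (A `&` B)%classic; first exact: GI.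
by rewrite !setTI preimage_setI.
Qed.

Section model.
Local Open Scope classical_set_scope.
Context d (Omega : measurableType d) (R : realType) (P : probability Omega R).
Variables (L : nat) (T tau Ps Pr sigmag2 p1 : R).
Variables (s : nat -> Omega -> 'I_L) (K : nat -> {RV P >-> nat}).
Variables (g : nat -> 'I_L -> {RV P >-> R[i]}) (f : 'I_L -> R[i]) (gamma : R).
Hypothesis obs : relay_observations p1 s K g sigmag2.

Let G := model_sigma s K g.
Let D := [set i : nat * (bool + 'I_L) | (0 < i.1)%N].

Lemma model_sigma_setI i : setI_closed (G i).
Proof.
case: i => m [[]|j]; apply: preimage_set_system_setI => //; exact: measurableI.
Qed.

Lemma model_sigma_measurable i : D i -> G i `<=` measurable.
Proof.
case: i => m [[]|j] m0; last 2 first.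
- exact: (winner_measurable obs m0).
- move=> _ [B mB <-]; exact: measurable_funP.
- move=> _ [B mB <-]; exact: measurable_funP.
Qed.

Let won m j := s m @^-1` [set j].

Lemma sigma_s_won m j : sigma_s s m (won m j).
Proof. by exists [set j] => //; rewrite setTI. Qed.

Lemma measurable_won m j : (0 < m)%N -> measurable (won m j).
Proof. by move=> m0; apply: (winner_measurable obs m0); exact: sigma_s_won. Qed.

Definition past n := [set i : nat * (bool + 'I_L) | (0 < i.1 <= n)%N].

Lemma past_observed n : past n `<=` D.
Proof. by move=> i /andP[]. Qed.

(** [winner_gain] selects a gain at random, so its events need not lie in a single [model_sigma];
    splitting by the winner expresses them through independent pieces. *)
Lemma won_gain_preimage m (B : 'I_L -> set R[i]) :
  [set w | B (s m w) (winner_gain s g m w)] =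
  \bigcup_(j in [set: 'I_L]) (won m j `&` g m j @^-1` (B j)).
Proof.
apply/seteqP; split => w /=; first by move=> Bw; exists (s m w).
by case=> j _ [/= <-].
Qed.

(** The filtration sees only the winners' gains; enlarging it to all past gains makes the joint
    independence applicable. *)
Lemma filtration_past n :
  filtration s K g n `<=` <<s cylinder G (past n) >>.
Proof.
pose U := g_sigma_algebraType (cylinder G (past n)).
have cyl i A : past n i -> G i A -> measurable (A : set U).
  move=> ni GA; apply: sub_sigma_algebra.
  apply: (@sub_cylinder _ _ _ _ [set i]); first by move=> _ ->.
  by apply: (cylinder1 (D := past n)).
apply: smallest_sub; first exact: smallest_sigma_algebra.
move=> A [m mn [[Am|Am]|[B mB <-]]].
- exact: (cyl (m, inl false)).
- exact: (cyl (m, inl true)).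
- rewrite setTI.
  have -> : winner_gain s g m @^-1` B = _ := won_gain_preimage m (fun=> B).
  apply: (@fin_bigcup_measurable _ U _ setT _ (@finite_finset _ _)) => j _.
  apply: (@measurableI _ U).
    by apply: (cyl (m, inl false)) => //; exact: sigma_s_won.
  by apply: (cyl (m, inr j)) => //; exists B => //; rewrite setTI.
Qed.

Lemma filtration_mono m n : (m <= n)%N ->
  filtration s K g m `<=` filtration s K g n.
Proof.
move=> mn; apply: sub_sigma_algebra2 => A [k /= /andP[k0 km] Ak].
by exists k => //=; rewrite k0 (leq_trans km).
Qed.

Lemma past_next_independent n (D2 : set (nat * (bool + 'I_L))) A B :
  D2 `<=` [set i | i.1 = n.+1] ->
  filtration s K g n A -> cylinder G D2 B ->
  (P (A `&` B) = P A * P B)%E.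
Proof.
move=> D2n FA cB.
have D2D : D2 `<=` D by move=> i /D2n /=; rewrite /D /= => ->.
have D12 : [disjoint past n & D2].
  apply/disj_set2P/seteqP; split => // i [/= /andP[_ i_n] /D2n /= i_eq].
  by rewrite i_eq ltnn in i_n.
by have [_ ->] := past_independent (fun i _ => @model_sigma_setI i)
  model_sigma_measurable (observations_independent obs) (@past_observed n) D2D D12
  (filtration_past FA) cB.
Qed.

Lemma filtration_measurable n : filtration s K g n `<=` measurable.
Proof.
move=> A /filtration_past.
apply: smallest_sub A; first exact: sigma_algebra_measurable.
exact: (cylinder_measurable model_sigma_measurable (@past_observed n)).
Qed.

(** Measurable sets of [R[i]] are preimages under [ReIm], so the Gaussian hypothesis fixes the whole
    law; observation 1 serves as the reference copy. *)
Lemma gain_law m j C : (0 < m)%N -> measurable C ->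
  P (g m j @^-1` C) = P (g 1%N j @^-1` C).
Proof.
move=> m0 [B mB <-]; rewrite setTI.
transitivity (distribution P (g m j) (@ReIm R @^-1` B)) => //.
rewrite (gain_gaussian obs _ m0)//.
by rewrite -(gain_gaussian obs j (ltn0Sn 0)).
Qed.

(** The past, the next winner and the next gain of relay [j] use disjoint indices, so the
    probability factors in three and two factors are regrouped. *)
Lemma next_gain_independent n j A C :
  filtration s K g n A -> measurable C ->
  (P ((A `&` won n.+1 j) `&` g n.+1 j @^-1` C) =
   P (A `&` won n.+1 j) * P (g 1%N j @^-1` C))%E.
Proof.
move=> FA mC; set iW := (n.+1, inl false : bool + 'I_L).
set iG := (n.+1, inr j : bool + 'I_L).
have cW : cylinder G [set iW] (won n.+1 j).
  by apply: (cylinder1 (D := D)) => //; exact: sigma_s_won.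
have cC : cylinder G [set iG] (g n.+1 j @^-1` C).
  by apply: (cylinder1 (D := D)) => //; exists C => //; rewrite setTI.
have sub (i : nat * (bool + 'I_L)) : D i -> [set i] `<=` D by move=> Di _ ->.
rewrite -setIA (@past_next_independent n [set iW; iG])//; last 2 first.
- by move=> _ [->|->].
- apply: (cylinder_setI (D := D) (fun i _ => @model_sigma_setI i)).
  + by move=> _ [->|->].
  + by apply: sub_cylinder cW => _ ->; left.
  + by apply: sub_cylinder cC => _ ->; right.
rewrite (@past_next_independent n [set iW] A)//; last by move=> _ ->.
rewrite -muleA -(@gain_law n.+1)//; congr (_ * _)%E.
apply: (cylinder_independent (D := D) (observations_independent obs)) cW cC.
- exact: sub.
- exact: sub.
- by apply/disj_set2P/seteqP; split => // i [/= ->].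
Qed.

Lemma measurable_winner d' (U : measurableType d') (psi : 'I_L -> R[i] -> U) m :
  (0 < m)%N -> (forall j, measurable_fun [set: R[i]] (psi j)) ->
  measurable_fun [set: Omega] (fun w => psi (s m w) (winner_gain s g m w)).
Proof.
move=> m0 mpsi _ B mB; rewrite setTI.
have -> : (fun w => psi (s m w) (winner_gain s g m w)) @^-1` B = _ :=
  won_gain_preimage m (fun j => psi j @^-1` B).
apply: fin_bigcup_measurable => // j _.
apply: measurableI; first exact: measurable_won.
rewrite -[X in measurable X]setTI; apply: measurable_funP => //.
by rewrite -[X in measurable X]setTI; exact: mpsi.
Qed.

(** Winning carries no information on the gains, so on the event that [j] wins the gain keeps its
    law. The factor after [P A] does not depend on [n], which makes the observations comparable. *)
Lemma integral_winner n A (psi : 'I_L -> R[i] -> \bar R) :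
  filtration s K g n A ->
  (forall j, measurable_fun [set: R[i]] (psi j)) ->
  (forall j z, 0 <= psi j z)%E ->
  (\int[P]_(w in A) psi (s n.+1 w) (winner_gain s g n.+1 w) =
   P A * \sum_(j < L) (L%:R^-1)%:E * \int[P]_w psi j (g 1%N j w))%E.
Proof.
move=> FA mpsi psi0.
have mA := filtration_measurable FA.
have mE j : measurable (A `&` won n.+1 j).
  by apply: measurableI => //; exact: measurable_won.
have AE : A = \big[setU/set0]_(j < L) (A `&` won n.+1 j).
  rewrite -bigcup_seq; apply/seteqP; split => [w Aw|w [j _ []]//].
  by exists (s n.+1 w) => //=; exact: mem_index_enum.
rewrite [in LHS]AE ge0_integral_bigsetU//=; last 3 first.
- exact: index_enum_uniq.
- by move=> i j _ _ [w [/= [_ <-] [_ <-]]].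
- by rewrite -AE; apply: measurable_funTS; exact: measurable_winner.
rewrite ge0_sume_distrr; last first.
  by move=> j _; rewrite mule_ge0 ?integral_ge0// lee_fin invr_ge0.
apply: eq_bigr => j _.
transitivity (\int[P]_(w in A `&` won n.+1 j) psi j (g n.+1 j w))%E.
  by apply: eq_integral => w; rewrite inE => -[_ /= <-].
rewrite (integral_independent (Z := g 1%N j) (mE j))//; last first.
  by move=> C mC; exact: next_gain_independent.
rewrite (@past_next_independent n [set (n.+1, inl false)] A)//; last first.
- by apply: (cylinder1 (D := D)) => //; exact: sigma_s_won.
- by move=> _ ->.
by rewrite (winner_uniform obs)// muleA.
Qed.

(** The splitting by the winner keeps [winner_gain] in place of [g n j], whose events the filtration
    need not contain. *)
Lemma filtration_winner n (B : 'I_L -> set R[i]) : (0 < n)%N ->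
  (forall j, measurable (B j)) ->
  filtration s K g n [set w | B (s n w) (winner_gain s g n w)].
Proof.
move=> n0 mB; rewrite (_ : [set w | _] = \bigcup_(j in [set: 'I_L])
    (won n j `&` winner_gain s g n @^-1` (B j))); last first.
  apply/seteqP; split => w /=; first by move=> Bw; exists (s n w).
  by case=> j _ [/= <-].
apply: (@fin_bigcup_measurable _ (g_sigma_algebraType _) _ setT _
  (@finite_finset _ _)) => j _.
apply: (@measurableI _ (g_sigma_algebraType _)); apply: sub_sigma_algebra.
  by exists n; [rewrite /= n0 leqnn|left; left; exact: sigma_s_won].
by exists n; [rewrite /= n0 leqnn|right; exists (B j); rewrite ?setTI].
Qed.

Lemma integral_slots n A : 0 < p_r L p1 -> filtration s K g n A ->
  (\int[P]_(w in A) (K n.+1 w)%:R%:E = P A * ((p_r L p1)^-1)%:E)%E.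
Proof.
move=> pr0 FA.
rewrite (integral_independent (Y := K n.+1) (Z := K n.+1)
  (phi := fun k : nat => k%:R%:E) (filtration_measurable FA))//; last first.
  move=> C mC; apply: (@past_next_independent n [set (n.+1, inl true)]) => //.
    by move=> _ ->.
  by apply: (cylinder1 (D := D)) => //; exists C => //; rewrite setTI.
congr (_ * _)%E; apply: integral_geometric => [|k k0].
  (* The bound p_r <= 1 comes from the model itself: P(K_1 = 2) = p_r (1 - p_r) is nonnegative. *)
  rewrite pr0 /= -subr_ge0 -(pmulr_rge0 _ pr0) -[1 - _]expr1 -lee_fin.
  by rewrite -(slots_geometric obs (ltn0Sn 0) (ltn0Sn 1)).
exact: (slots_geometric obs).
Qed.

End model.

(** * Optimality of the threshold rule in the relay model *)

Lemma first_time_ext d (Omega : measurableType d) (C C' : nat -> Omega -> bool) :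
  (forall m w, C m w = C' m w) -> first_time C = first_time C'.
Proof. by move=> CC'; congr first_time; apply/funext => m; apply/funext. Qed.

(** Transfers finite means between elapsed time and slot count, in both directions. *)
Lemma affine_expectation_lty d (Omega : measurableType d) (R : realType)
  (P : probability Omega R) (h k : Omega -> R) (a b : R) :
  measurable_fun [set: Omega] h -> measurable_fun [set: Omega] k ->
  (forall w, 0 <= k w) ->
  (forall w, 0 <= h w <= a + b * k w) ->
  ('E_P[k] < +oo -> 'E_P[h] < +oo)%E.
Proof.
move=> mh mk k0 hk Ek.
have ik : P.-integrable setT (EFin \o k).
  by apply/Lfun1_integrable; exact: ge0_Lfun1.
have iabk : P.-integrable setT (cst a%:E \+ (fun w => b%:E * (EFin \o k) w))%E.
  apply: integrableD => //; first exact: finite_measure_integrable_cst.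
  exact: integrableZl.
rewrite unlock; apply: integrable_lty => //.
apply: le_integrable iabk => //; first exact/measurable_EFinP.
move=> w _ /=; have /andP[h0 hle] := hk w.
by rewrite lee_fin !ger0_norm// (le_trans h0).
Qed.

Theorem theorem5 (d : measure_display) (Omega : measurableType d)
  (R : realType) (P : probability Omega R)
  (L : nat) (T tau Ps Pr sigmag2 p1 : R)
  (s : nat -> Omega -> 'I_L) (K : nat -> {RV P >-> nat})
  (g : nat -> 'I_L -> {RV P >-> R[i]})
  (f : 'I_L -> R[i]) (gamma : R)
  (L_ge1 : (1 <= L)%N) (T_gt0 : 0 < T) (tau_gt0 : 0 < tau)
  (Ps_gt0 : 0 < Ps) (Pr_gt0 : 0 < Pr) (sigmag2_gt0 : 0 < sigmag2)
  (p1_gt0 : 0 < p1) (p1_lt1 : p1 < 1)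
  (obs : relay_observations p1 s K g sigmag2)
  (gamma_gt0 : 0 < gamma) :
  exists2 W : R, opt_value T tau Ps Pr f s K g gamma = W%:E &
    let M := threshold_rule T Ps Pr f s g gamma W in
    [/\ stopping_rule T tau s K g M,
        'E_P[stopped (reward T tau Ps Pr f s K g gamma) M]%E = W%:E &
        forall m, (1 <= m)%N ->
          'E_P[(fun w => Num.max (T / 2 * rate Ps Pr f s g m w - T / 2 * gamma)
                                 W)%R]%E
          = (W + gamma * tau / (2 * p_r L p1))%:E].
Proof.
have pr0 : 0 < p_r L p1.
  by rewrite /p_r !mulr_gt0 ?ltr0n// exprn_gt0// subr_gt0.
pose x (j : 'I_L) z := T / 2 * link_rate Ps Pr (f j) z - T / 2 * gamma.
have mx j : measurable_fun [set: R[i]] (x j).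
  apply: measurable_funB => //; apply: measurable_funM => //.
  exact: (measurable_link_rate Ps_gt0 Pr_gt0).
pose X m w := x (s m w) (winner_gain s g m w).
(* Summing over all relays dominates the rate of whichever relay wins; the last term absorbs the
   shift in [x]. *)
pose b := T / 2 * (\sum_(j < L) log2 (1 + Ps * sqmod (f j))) + T / 2 * gamma.
have logP j : 0 <= log2 (1 + Ps * sqmod (f j)).
  by have /andP[r0 /(le_trans r0)] := link_rate_bounds Ps_gt0 Pr_gt0 (f j) 0.
have Xb m w : `|X m w| <= b.
  have /andP[r0 rle] :=
    link_rate_bounds Ps_gt0 Pr_gt0 (f (s m w)) (winner_gain s g m w).
  have /(ler_wpM2l (ltW (divr_gt0 T_gt0 (ltr0n R 2)))) rb :
      link_rate Ps Pr (f (s m w)) (winner_gain s g m w)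
      <= \sum_(j < L) log2 (1 + Ps * sqmod (f j)).
    by rewrite (bigD1 (s m w))//= (le_trans rle)// lerDl sumr_ge0.
  have Tr := mulr_ge0 (ltW (divr_gt0 T_gt0 (ltr0n R 2))) r0.
  have Tg := mulr_gt0 (divr_gt0 T_gt0 (ltr0n R 2)) gamma_gt0.
  by rewrite ler_norml /X /x /b; apply/andP; split; lra.
have mX m : (0 < m)%N -> measurable_fun [set: Omega] (X m).
  by move=> m0; exact: (measurable_winner obs m0 mx).
have c0 : 0 < gamma * tau / (2 * p_r L p1).
  by apply: divr_gt0; exact: mulr_gt0.
(* The level is chosen so that the mean excess of observation 1 equals the mean cost of one
   observation; only later is it identified with the optimal value. *)
have [W EW] := excess_level P (mX 1%N isT) (Xb 1%N) c0.
pose a := gamma * tau / 2.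
have a0 : 0 < a by rewrite !mulr_gt0.
pose k := (p_r L p1)^-1.
have k0 : 0 < k by rewrite invr_gt0.
have ak : gamma * tau / (2 * p_r L p1) = a * k by rewrite /a /k; field; rewrite gt_eqF.
have excess n A : filtration s K g n A ->
    (\int[P]_(w in A) (Num.max (X n.+1 w - W) 0)%:E = P A * (a * k)%:E)%E.
  move=> FA.
  pose psi j z := (Num.max (x j z - W) 0)%:E.
  have mpsi j : measurable_fun [set: R[i]] (psi j).
    by apply/measurable_EFinP/measurable_maxr => //; exact: measurable_funB.
  have psi0 j z : (0 <= psi j z)%E by rewrite lee_fin le_max lexx orbT.
  (* [integral_winner] is used for [A] and then for observation 1 on the whole space, which carries
     [EW] over to every observation. *)
  rewrite (integral_winner obs FA mpsi psi0) -ak -EW.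
  have FT : filtration s K g 0 setT by exact: (@measurableT _ (g_sigma_algebraType _)).
  by rewrite (integral_winner obs FT mpsi psi0) probability_setT mul1e.
pose Kr n w : R := (K n w)%:R.
have mKr n : (0 < n)%N -> measurable_fun [set: Omega] (Kr n).
  by move=> _; exact: measurableT_comp.
have Kr0 n w : 0 <= Kr n w by [].
have meanK n A : filtration s K g n A ->
  (\int[P]_(w in A) (Kr n.+1 w)%:E = P A * k%:E)%E := integral_slots obs pr0.
have adapted n : (0 < n)%N -> filtration s K g n [set w | W <= X n w]%classic.
  move=> n0.
  apply: (filtration_winner (B := fun j => [set z | W <= x j z]%classic)) => // j.
  rewrite (_ : [set z | _]%classic = (x j @^-1` `[W, +oo[)%classic); last first.
    by apply/seteqP; split => z /=; rewrite in_itv/= andbT.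
  by rewrite -[X in measurable X]setTI; exact: mx.
have mF := filtration_measurable obs.
have monoF m n : (m <= n)%N ->
    (filtration s K g m `<=` filtration s K g n)%classic.
  exact: filtration_mono.
pose S n w : R := \sum_(1 <= i < n.+1) Kr i w.
(* The fixed delay T/2 is charged to [X], so only the contention slots remain as cost, at price [a]
   each. *)
have rewardE M : stopped (reward T tau Ps Pr f s K g gamma) M =
    stopped (fun n w => X n w - a * S n w) M.
  congr stopped; apply/funext => n; apply/funext => w.
  rewrite /reward /payoff /elapsed /X /x /link_rate /rate /a /S /Kr.
  by ring.
have thresholdE : threshold_rule T Ps Pr f s g gamma W =
    first_time (fun m w => W <= X m w).
  by apply: first_time_ext => m w; rewrite /X /x lerBrDr.
have mS n : measurable_fun [set: Omega] (S n).
  rewrite (_ : S n = (fun w => \sum_(i < n) Kr i.+1 w)); last first.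
    by apply/funext => w; rewrite /S big_add1 /= big_mkord.
  by apply: measurable_sum => i; exact: mKr.
have S0 n w : 0 <= S n w by exact: sumr_ge0.
have mE n : measurable_fun [set: Omega] (elapsed T tau K n).
  by apply: measurable_funD => //; apply: measurable_funM => //; exact: mS.
have stopM : stopping_rule T tau s K g (threshold_rule T Ps Pr f s g gamma W).
  rewrite thresholdE; split.
  - exact: (first_time_stopping monoF adapted).
  - by move=> w; exact: first_time_gt0.
  - exact: (first_time_never mF monoF mX Xb a0 k0 excess adapted).
  - have mM n :
        measurable (first_time (fun m w => W <= X m w) @^-1` [set Some n])%classic.
      by apply: (mF n); exact: (first_time_stopping monoF adapted).
    have fin := first_time_finite mF monoF mX mKr Xb Kr0 a0 k0 excess meanK adapted.
    apply: (affine_expectation_lty (a := T / 2) (b := tau / 2) _ _ _ _ fin).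
    + by apply: (measurable_stopped mM (@first_time_gt0 _ _ _ X W)) => n _; exact: mE.
    + by apply: (measurable_stopped mM (@first_time_gt0 _ _ _ X W)) => n _; exact: mS.
    + by move=> w; rewrite /stopped; case: first_time => // n; exact: S0.
    + move=> w; rewrite /stopped; case: first_time => [n|].
        by rewrite /elapsed lexx andbT addr_ge0 ?mulr_ge0 ?divr_ge0 ?S0// ltW.
      by rewrite lexx mulr0 addr0 divr_ge0// ltW.
have rewardM : 'E_P[stopped (reward T tau Ps Pr f s K g gamma)
    (threshold_rule T Ps Pr f s g gamma W)]%E = W%:E.
  rewrite rewardE thresholdE.
  exact: (first_time_reward mF monoF mX mKr Xb Kr0 a0 k0 excess meanK adapted).
exists W.
  apply/eqP; rewrite eq_le; apply/andP; split; last first.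
    by apply: ereal_sup_ubound; exists (threshold_rule T Ps Pr f s g gamma W).
  apply: ge_ereal_sup => _ [M [tM M0 MN fin] <-]; rewrite rewardE.
  apply: (stopping_le mF monoF mX mKr Xb Kr0 a0 k0 excess meanK tM M0 MN).
  have mM n : measurable (M @^-1` [set Some n])%classic by apply: (mF n); exact: tM.
  (* At a finite stopping time, 2/tau times the elapsed time exceeds the slot count by T/tau; when M
     = +oo both default to 0. *)
  apply: (affine_expectation_lty (a := 0) (b := 2 / tau) _ _ _ _ fin).
  - by apply: (measurable_stopped mM M0) => n _; exact: mS.
  - by apply: (measurable_stopped mM M0) => n _; exact: mE.
  - move=> w; rewrite /stopped; case: (M w) => // n.
    by rewrite addr_ge0 ?mulr_ge0 ?divr_ge0 ?S0// ltW.
  - move=> w; rewrite /stopped; case: (M w) => [n|]; last by rewrite mulr0 addr0 lexx.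
    have -> : 0 + 2 / tau * elapsed T tau K n w = T / tau + S n w.
      by rewrite /elapsed -/(S n w); field; rewrite gt_eqF.
    by rewrite S0 lerDr divr_ge0// ltW.
split=> // -[//|m] _.
have mphi : measurable_fun [set: Omega] (fun w => Num.max (X m.+1 w - W) 0).
  by apply: measurable_maxr => //; apply: measurable_funB => //; exact: mX.
have FT : filtration s K g m setT by exact: (@measurableT _ (g_sigma_algebraType _)).
have Ephi : 'E_P[(fun w => Num.max (X m.+1 w - W) 0)%R]%E = (a * k)%:E.
  by rewrite unlock excess// probability_setT mul1e.
(* Since max(x, W) = (x - W)^+ + W, the equation for [W] is the choice of the level shifted by
   [W]. *)
transitivity ('E_P[((fun w => Num.max (X m.+1 w - W) 0) \+ cst W)%R])%E.
  congr expectation; apply/funext => w /=.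
  by rewrite addr_maxl subrK add0r.
rewrite expectationD.
- by rewrite Ephi expectation_cst ak -EFinD addrC.
- apply: ge0_Lfun1 => //; first by move=> w; rewrite le_max lexx orbT.
  by rewrite Ephi ltry.
- by apply/Lfun1_integrable; exact: finite_measure_integrable_cst.
Qed.
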